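(* Let $S$ be a semigroup, let $n\geq 1$ be a natural number and let $\mathcal{F}$ be a family of functions from $S^n$ to $S$ which is transitive and reflexive. Then $W(\beta S,\mathcal{F})\neq\emptyset$, i.e. there exists a weakly maximal ultrafilter in $(\beta S,\leq_{\mathcal{F}})$.
   Context: For $A,B\subseteq S$, $A\leq_{\mathcal{F}}B$ means that for every finite $F\subseteq A$ there is $f\in\mathcal{F}$ with $f(F^{n})=\{f(a_1,\dots,a_n)\mid a_i\in F\}\subseteq B$. The family $\mathcal{F}$ is transitive (resp. reflexive) if the relation $\leq_{\mathcal{F}}$ on the power set of $S$ is transitive (resp. reflexive). For $\mathcal{U},\mathcal{V}\in\beta S$, $\mathcal{U}\leq_{\mathcal{F}}\mathcal{V}$ means that for every $B\in\mathcal{V}$ there is $A\in\mathcal{U}$ with $A\leq_{\mathcal{F}}B$. An ultrafilter $\mathcal{U}\in\beta S$ is weakly maximal if for every $\mathcal{V}\in\beta S$, $\mathcal{U}\leq_{\mathcal{F}}\mathcal{V}$ implies $\mathcal{V}\leq_{\mathcal{F}}\mathcal{U}$; $W(\beta S,\mathcal{F})$ is the set of weakly maximal ultrafilters. *)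

(* Defs.v *)
From Corelib Require Export RelationClasses.
From mathcomp Require Export all_boot.
From mathcomp Require Export boolp classical_sets cardinality filter.

Set Implicit Arguments.
Unset Strict Implicit.
Unset Printing Implicit Defensive.

Local Open Scope classical_set_scope.

Section FinitelyEmbeddable.
Context {S : Type} {n : nat}.
Implicit Types (F : set (n.-tuple S -> S)) (A B E : set S) (U V : set_system S).

Definition tuple_power E : set (n.-tuple S) :=
  [set t | forall i : 'I_n, E (tnth t i)].

Definition le_set F A B : Prop :=
  forall E, finite_set E -> E `<=` A ->
    exists2 f, F f & f @` tuple_power E `<=` B.

Definition transitive_family F : Prop := RelationClasses.Transitive (le_set F).

Definition reflexive_family F : Prop := RelationClasses.Reflexive (le_set F).

Definition le_ultra F U V : Prop :=
  forall B, V B -> exists2 A, U A & le_set F A B.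

End FinitelyEmbeddable.

(* The points of the Stone-Cech compactification of the discrete space S:
   all ultrafilters on S, principal ones included. *)
Definition beta (S : Type) : set (set_system S) := [set U | UltraFilter U].

Definition weakly_maximal (S : Type) (n : nat) (F : set (n.-tuple S -> S)) :
    set (set_system S) :=
  [set U | beta U /\
           forall V, beta V -> le_ultra F U V -> le_ultra F V U].

(* Main.v *)
Require Import Defs.

(* By Zorn's lemma for preorders it suffices to bound a nonempty chain C of
   ultrafilters. The sets lying eventually in the members of C form a proper
   filter; let V be an ultrafilter extending it. Every B in V lies in
   arbitrarily late members of C, as otherwise its complement would be in V, so
   each U in C is below some U' in C containing B, and U <= U' yields a set
   A in U with A <= B. *)

Local Open Scope classical_set_scope.

Section LeUltra.
Context {S : Type} {n : nat} (F : set (n.-tuple S -> S)).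

Lemma le_ultra_refl : reflexive_family F -> forall U, le_ultra F U U.
Proof. by move=> Frefl U B UB; exists B => //; exact: Frefl. Qed.

Lemma le_ultra_trans : transitive_family F ->
  forall U V W, le_ultra F U V -> le_ultra F V W -> le_ultra F U W.
Proof.
move=> Ftrans U V W UV VW C /VW[B /UV[A UA AB] BC].
by exists A => //; exact: Ftrans AB BC.
Qed.

Lemma tail_filter_proper (C : set (set_system S)) :
  transitive_family F -> reflexive_family F ->
  C !=set0 -> C `<=` @beta S -> total_on C (le_ultra F) ->
  ProperFilter [set A | exists2 U, C U &
    forall V, C V -> le_ultra F U V -> V A].
Proof.
move=> Ftrans Frefl [U0 CU0] Cbeta Ctot; split.
  (* By reflexivity [U] belongs to its own tail, so an empty tail set would lie in [U]. *)
  move=> [U CU /(_ U CU (le_ultra_refl Frefl U))].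
  by have ? : UltraFilter U := Cbeta U CU; exact: filter_not_empty.
split.
- exists U0 => // V CV _.
  by have ? : UltraFilter V := Cbeta V CV; exact: filterT.
- move=> A B [U CU UA] [V CV VB].
  (* The later of the two starting points serves for [A] and [B] together: by transitivity its tail
     lies inside the other one. *)
  have [UV|VU] := Ctot U V CU CV.
  + exists V => // W CW VW; have ? : UltraFilter W := Cbeta W CW.
    by apply: filterI; [apply: UA => //; exact: le_ultra_trans VW|exact: VB].
  + exists U => // W CW UW; have ? : UltraFilter W := Cbeta W CW.
    by apply: filterI; [exact: UA|apply: VB => //; exact: le_ultra_trans UW].
- move=> A B AB [U CU UA]; exists U => // V CV UV.
  by have ? : UltraFilter V := Cbeta V CV; apply: filterS AB _; exact: UA.
Qed.

Lemma chain_upper_bound (C : set (set_system S)) :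
  transitive_family F -> reflexive_family F ->
  C !=set0 -> C `<=` @beta S -> total_on C (le_ultra F) ->
  exists2 V, beta V & forall U, C U -> le_ultra F U V.
Proof.
move=> Ftrans Frefl C0 Cbeta Ctot.
have [V [Vultra tailV]] :=
  ultraFilterLemma (@tail_filter_proper C Ftrans Frefl C0 Cbeta Ctot).
exists V => // U CU B VB.
have [U' [CU' UU' U'B]] : exists U', [/\ C U', le_ultra F U U' & U' B].
  apply: contrapT => noU'.
  have VnB : V (~` B).
    (* The tail from [U] itself works: each [W] in it omits [B] by [noU'], hence contains the
       complement. *)
    apply: tailV; exists U => // W CW UW.
    have Wultra : UltraFilter W := Cbeta W CW.
    by have [WB|//] := in_ultra_setVsetC B Wultra; case: noU'; exists W.
  by apply: (@filter_not_empty _ V); rewrite -(setICr B); exact: filterI.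
exact: UU'.
Qed.

Lemma weakly_maximal_nonempty : [set: S] !=set0 ->
  transitive_family F -> reflexive_family F -> weakly_maximal F !=set0.
Proof.
move=> [s _] Ftrans Frefl.
(* Zorn is run on the subtype of ultrafilters, so that the bounds and the maximal element are
   ultrafilters too. *)
pose R (U V : {U : set_system S | UltraFilter U}) :=
  `[< le_ultra F (sval U) (sval V) >].
pose U0 : {U : set_system S | UltraFilter U} :=
  exist _ _ (principal_filter_ultra s).
have [|U V W /asboolP UV /asboolP VW|C Ctot|[U Uultra] Umax] :=
  @ZL_preorder _ U0 R.
- by move=> U; apply/asboolP; exact: le_ultra_refl.
- by apply/asboolP; exact: le_ultra_trans UV VW.
(* The empty chain has no tails; the principal ultrafilter [U0] bounds it vacuously. *)
- have [[U1 CU1]|C0] := pselect (C !=set0); last first.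
    by exists U0 => U CU; case: C0; exists U.
  have [//|//||||V Vultra CV] := @chain_upper_bound [set sval U | U in C].
  + by exists (sval U1); exists U1.
  + by move=> _ [[U Uultra] _ <-].
  + move=> _ _ [U CU <-] [V CV <-].
    by have [/asboolP|/asboolP] := Ctot U V CU CV; [left|right].
  by exists (exist _ V Vultra) => U CU; apply/asboolP/CV; exists U.
(* Maximality for a preorder, where being below [V] forces [V] to be below, is exactly weak
   maximality. *)
- exists U; split => // V Vultra UV.
  by apply/asboolP/(Umax (exist _ V Vultra))/asboolP.
Qed.

End LeUltra.

Theorem corollary3p10 (S : semigroupType) (S_nonempty : [set: S] !=set0)
  (n : nat) (n_ge1 : (1 <= n)%N) (F : set (n.-tuple S -> S))
  (F_trans : transitive_family F) (F_refl : reflexive_family F) :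
  weakly_maximal F !=set0.
Proof. exact: weakly_maximal_nonempty. Qed.
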